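(* Let $F_n$ be a $2$-regular graph with $n$ vertices. Then $F_n$ is potentially triangulable in the convex complete graph $K_n$ if and only if $F_n$ is not isomorphic to any of $C_3, C_4, C_5, C_6, C_3\cup C_3, C_3\cup C_4$ (where $C_k$ is the $k$-cycle and $\cup$ denotes disjoint union).
   Context: A convex complete graph $K_n$ is the complete graph on $n$ points in convex position in the plane, edges drawn as straight-line segments. For a subgraph $F$ of $K_n$, $K_n-F$ is obtained by deleting the edges of $F$ (all vertices kept). A convex graph on $n$ vertices admits a triangulation if it contains all $n$ boundary edges (edges between vertices consecutive along the convex hull boundary) and $n-3$ pairwise non-crossing diagonals. A graph $F$ with $n$ vertices is potentially triangulable in $K_n$ if there is a bijective placement of its vertices on the vertices of $K_n$ (edges becoming the corresponding edges of $K_n$) such that $K_n-F$ admits a triangulation. *)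

(* Defs.v *)
From mathcomp Require Import all_boot all_order all_algebra.
From mathcomp Require Import reals.

Set Implicit Arguments.
Unset Strict Implicit.
Unset Printing Implicit Defensive.

Import Order.TTheory GRing.Theory Num.Theory.
Local Open Scope ring_scope.

Definition simple_graph (V : finType) (e : rel V) : Prop :=
  symmetric e /\ irreflexive e.

Definition regular (k : nat) (V : finType) (e : rel V) : Prop :=
  forall v : V, #|[set w | e v w]| = k.

Definition isomorphic (V W : finType) (e : rel V) (e' : rel W) : Prop :=
  exists f : V -> W, bijective f /\ forall x y, e' (f x) (f y) = e x y.

(* [ordS] is the successor modulo k; this is the cycle C_k only for k >= 3. *)
Definition cycle_graph (k : nat) : rel 'I_k :=
  fun i j => (j == ordS i) || (i == ordS j).

Definition disjoint_union (V W : finType) (e : rel V) (e' : rel W) :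
    rel (V + W)%type :=
  fun x y => match x, y with
             | inl v, inl v' => e v v'
             | inr w, inr w' => e' w w'
             | _, _ => false
             end.

Definition complete_graph (V : finType) : rel V := fun x y => x != y.

Definition delete_edges (V : finType) (g h : rel V) : rel V :=
  fun x y => g x y && ~~ h x y.

Definition image_graph (V W : finType) (f : V -> W) (e : rel V) : rel W :=
  fun i j => [exists x, [exists y, [&& e x y, f x == i & f y == j]]].

(* No point lies in the convex hull of the others; in particular the points
   are distinct and no three of them are collinear. *)
Definition convex_position (R : realType) (n : nat) (p : 'I_n -> 'rV[R]_2) :
    Prop :=
  forall i : 'I_n,
    ~ exists w : 'I_n -> R,
        [/\ forall j, 0 <= w j,
            \sum_(j | j != i) w j = 1
          & \sum_(j | j != i) w j *: p j = p i].

(* The segment from p i to p j is an edge of the convex hull: some supporting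
   line (p k *m u = c) of the point set contains p i, p j and no other point. *)
Definition boundary_edge (R : realType) (n : nat) (p : 'I_n -> 'rV[R]_2)
    (i j : 'I_n) : Prop :=
  i != j /\
  exists (u : 'cV[R]_2) (c : R),
    forall k : 'I_n, (p k *m u) 0 0 <= c ?= iff (k \in [set i; j]).

Definition open_segment (R : realType) (a b x : 'rV[R]_2) : Prop :=
  exists t : R, 0 < t < 1 /\ x = (1 - t) *: a + t *: b.

Definition segments_cross (R : realType) (a b c d : 'rV[R]_2) : Prop :=
  exists x : 'rV[R]_2, open_segment a b x /\ open_segment c d x.

(* Edges are unordered pairs, so that #|D| counts each diagonal once. *)
Definition admits_triangulation (R : realType) (n : nat)
    (p : 'I_n -> 'rV[R]_2) (g : rel 'I_n) : Prop :=
  (forall i j, boundary_edge p i j -> g i j) /\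
  exists D : {set {set 'I_n}},
    [/\ #|D| = (n - 3)%N,
        forall E, E \in D ->
          exists i j, [/\ E = [set i; j], i != j, g i j & ~ boundary_edge p i j]
      & forall i j k l, [set i; j] \in D -> [set k; l] \in D ->
          [set i; j] != [set k; l] -> ~ segments_cross (p i) (p j) (p k) (p l)].

Definition potentially_triangulable (R : realType) (n : nat)
    (p : 'I_n -> 'rV[R]_2) (V : finType) (e : rel V) : Prop :=
  exists f : V -> 'I_n,
    bijective f /\
    admits_triangulation p
      (delete_edges (@complete_graph 'I_n) (image_graph f e)).

(* Main.v *)
Require Import Defs.
From mathcomp Require Import all_boot all_order all_algebra.
From mathcomp Require Import reals.
From mathcomp Require Import ring lra zify.

(* Label the points counterclockwise, so that boundary edges join consecutive
   labels and segments cross exactly when their end labels interleave.  The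
   zigzag triangulation of the polygon is the square of a Hamiltonian path, so
   it is enough to list the vertices of the 2-regular graph F in such a way
   that F-adjacent vertices are at distance at least 3 in the list.  Such
   lists of vertex-disjoint unions of cycles can be concatenated; a cycle of
   length at least 7 has one (even positions, then odd positions), and a
   cycle of length at most 6 can be inserted in any list of length at least 4.
   So it suffices to start from one long cycle, or from two or three short
   cycles with at least 8 vertices in total; what remains is exactly the list
   of exceptions, which are excluded by an exhaustive search. *)

Set Implicit Arguments.
Unset Strict Implicit.
Unset Printing Implicit Defensive.

(** * Cycles and spread lists *)

Section Arrangements.

Variable T : eqType.
Implicit Types (x y : T) (c s : seq T) (cs : seq (seq T)) (e : rel T).

Definition links c := zip c (rot 1 c).

Definition adjacent c : rel T :=
  fun x y => ((x, y) \in links c) || ((y, x) \in links c).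

Definition cycles_rel cs : rel T := fun x y => has (fun c => adjacent c x y) cs.

(** Each entry is tested only against the two after it; for symmetric [e] this says that related
    entries are at distance at least 3. *)
Fixpoint spread e s : bool :=
  if s is x :: s' then all (fun y => ~~ e x y) (take 2 s') && spread e s'
  else true.

Definition arrangeable cs : Prop :=
  exists2 s, perm_eq s (flatten cs) & spread (cycles_rel cs) s.

Lemma mem_links c x y : (x, y) \in links c -> (x \in c) && (y \in c).
Proof.
move=> h.
have sz : size c = size (rot 1 c) by rewrite size_rot.
have : x \in unzip1 (links c) by apply: (map_f fst h).
have : y \in unzip2 (links c) by apply: (map_f snd h).
by rewrite /links unzip1_zip ?sz // unzip2_zip ?sz // mem_rot => -> ->.
Qed.

Lemma mem_adjacent c x y : adjacent c x y -> (x \in c) && (y \in c).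
Proof. by case/orP=> /mem_links // /andP[-> ->]. Qed.

Lemma adjacentC c : symmetric (adjacent c).
Proof. by move=> x y; rewrite /adjacent orbC. Qed.

Lemma cycles_relC cs : symmetric (cycles_rel cs).
Proof. by move=> x y; apply: eq_has => c; rewrite adjacentC. Qed.

Lemma mem_cycles_rel cs x y :
  cycles_rel cs x y -> (x \in flatten cs) && (y \in flatten cs).
Proof.
case/hasP=> c c_cs /mem_adjacent /andP[xc yc].
by apply/andP; split; apply/flattenP; exists c.
Qed.

Lemma spread_eq e e' s :
  {in s &, e =2 e'} -> spread e s = spread e' s.
Proof.
elim: s => //= x s IHs ee'; congr andb; last first.
  by apply: IHs => y z ys zs; apply: ee'; rewrite inE ?ys ?zs orbT.
apply: eq_in_all => y /mem_take ys.
by rewrite ee' // inE ?eqxx ?ys ?orbT.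
Qed.

Lemma spread_cat e s1 s2 :
  {in s1 & s2, forall x y, ~~ e x y} -> spread e s1 -> spread e s2 ->
  spread e (s1 ++ s2).
Proof.
elim: s1 => //= x s1 IHs ne /andP[h1 h2] h3; apply/andP; split; last first.
  by apply: IHs => // y z ys zs; apply: ne; rewrite // inE ys orbT.
apply/allP => y; rewrite take_cat; case: ltnP => hs; first by move/(allP h1).
rewrite mem_cat => /orP[ys|/mem_take ys]; last by apply: ne; rewrite ?inE ?eqxx.
by move: h1; rewrite take_oversize // => /allP; apply.
Qed.

Lemma spread_nth x0 e s :
  (forall i j, i < j -> j <= i.+2 -> j < size s ->
    ~~ e (nth x0 s i) (nth x0 s j)) <->
  spread e s.
Proof.
elim: s => [|x s IHs] /=; first by split.
split=> [h|/andP[h1 /IHs h2]].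
  apply/andP; split; last first.
    by apply/IHs => i j ij ji js; apply: (h i.+1 j.+1); lia.
  apply/(all_nthP x0) => i; rewrite size_take => hi.
  have [hi2 his] : i < 2 /\ i < size s by move: hi; case: (ltnP 2 (size s)); lia.
  by rewrite nth_take //; apply: (h 0 i.+1).
case=> [|i] [|j] //= ij ji js; last by apply: h2.
have/allP := h1; apply; rewrite -(@nth_take 2) //.
by apply: mem_nth; rewrite size_take; case: (ltnP 2 (size s)); lia.
Qed.

Lemma perm_cycles_rel cs cs' :
  perm_eq cs cs' -> cycles_rel cs =2 cycles_rel cs'.
Proof. by move=> p x y; apply: eq_has_r => c; apply: perm_mem. Qed.

Lemma perm_arrangeable cs cs' :
  perm_eq cs cs' -> arrangeable cs -> arrangeable cs'.
Proof.
move=> p [s ps hs]; exists s; first exact: perm_trans ps (perm_flatten p).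
by rewrite -(spread_eq (e := cycles_rel cs)) // => x y _ _; apply: perm_cycles_rel.
Qed.

Lemma arrangeable_cat cs1 cs2 : uniq (flatten (cs1 ++ cs2)) ->
  arrangeable cs1 -> arrangeable cs2 -> arrangeable (cs1 ++ cs2).
Proof.
rewrite flatten_cat cat_uniq => /and3P[_ /hasPn dis _] [s1 p1 h1] [s2 p2 h2].
exists (s1 ++ s2); first by rewrite flatten_cat perm_cat.
have cross x y : x \in flatten cs1 -> y \in flatten cs2 ->
    ~~ cycles_rel (cs1 ++ cs2) x y.
  move=> x1 y2; apply/negP; rewrite /cycles_rel has_cat => /orP[].
    by case/mem_cycles_rel/andP => _ y1; have := dis y y2; rewrite /= y1.
  by case/mem_cycles_rel/andP => x2 _; have := dis x x2; rewrite /= x1.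
apply: spread_cat.
- by move=> x y; rewrite (perm_mem p1) (perm_mem p2); apply: cross.
- rewrite -(spread_eq (e := cycles_rel cs1)) // => x y.
  rewrite !(perm_mem p1) => x1 y1; rewrite [RHS]/cycles_rel has_cat.
  rewrite -[has _ cs2]/(cycles_rel cs2 x y); case: (boolP (cycles_rel cs2 x y)).
    by case/mem_cycles_rel/andP => x2 _; have := dis x x2; rewrite /= x1.
  by rewrite orbF.
- rewrite -(spread_eq (e := cycles_rel cs2)) // => x y.
  rewrite !(perm_mem p2) => x2 y2; rewrite [RHS]/cycles_rel has_cat.
  rewrite -[has _ cs1]/(cycles_rel cs1 x y); case: (boolP (cycles_rel cs1 x y)).
    by case/mem_cycles_rel/andP => x1 _; have := dis x x2; rewrite /= x1.
  by [].
Qed.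

(** * Inserting a cycle of length 3 to 6 into a list *)

Ltac perm_count :=
  let P := fresh "P" in apply/permP => P; rewrite /= ?count_cat /=;
  generalize (count P); repeat match goal with
  |- context [nat_of_bool ?b] => generalize (nat_of_bool b) end; clear; lia.

(** Three sources of non-adjacency: a recorded hypothesis, the links of [c] for two of its vertices,
    and disjointness for a vertex of [c] against one of [x1] to [x4]. *)
Ltac solve_nonadjacent inc dx := match goal with
  | H : is_true ?P |- is_true ?P => exact H
  | |- is_true (~~ _) => solve
     [ by rewrite inc ?inE ?eqxx ?orbT // /adjacent /links /= !inE !xpair_eqE;
       repeat match goal with
         H : (?a == ?b) = false |- context[?a == ?b] => rewrite H
       end;
       rewrite ?eqxx ?andbF
     | by (refine (proj1 (andP (dx _ _ _ _))); rewrite ?inE ?eqxx ?orbT)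
     | by (refine (proj2 (andP (dx _ _ _ _))); rewrite ?inE ?eqxx ?orbT) ]
  end.

Ltac solve_spread inc dx dr :=
  repeat match goal with
  | H : is_true (_ && _) |- _ => move/andP: H => [] ? ?
  | H : is_true (_ \notin _) |- _ => rewrite !inE ?negb_or in H
  | H : is_true (?a != ?b) |- _ =>
      pose proof (negbTE H);
      pose proof (negbTE (etrans (congr1 negb (eq_sym b a)) H)); clear H
  end;
  rewrite /= ?take0 /=; repeat (apply/andP; split);
  (solve [ done | by apply: dr; rewrite !inE eqxx ?orbT | solve_nonadjacent inc dx]).

(** The old list keeps its order, so distances inside it do not decrease, and no edge joins it to
    [c]. It remains to intersperse the vertices of [c] among the first four old ones, by one
    explicit pattern for each length. *)
Lemma arrangeable_insert c cs :
  2 < size c <= 6 -> 3 < size (flatten cs) -> uniq (c ++ flatten cs) ->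
  arrangeable cs -> arrangeable (c :: cs).
Proof.
move=> hc hcs U [s ps hs].
have dis x y : x \in c -> y \in s -> ~~ cycles_rel (c :: cs) x y.
  move: U; rewrite cat_uniq => /and3P[_ /hasPn d _] xc ys; apply/negP => /=.
  have := d y; rewrite -(perm_mem ps) => /(_ ys) /negP ny.
  case/orP=> [/mem_adjacent/andP[] // |/mem_cycles_rel/andP[xs _]].
  by have := d x xs; rewrite /= xc.
have dis' x y : x \in c -> y \in s -> ~~ cycles_rel (c :: cs) y x.
  by rewrite cycles_relC; apply: dis.
have same x y : x \in s -> y \in s -> cycles_rel (c :: cs) x y = cycles_rel cs x y.
  move: U; rewrite cat_uniq => /and3P[_ /hasPn d _] xs ys.
  rewrite /cycles_rel /=; case: (boolP (adjacent c x y)) => // /mem_adjacent.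
  case/andP=> xc _; have := d x; rewrite -(perm_mem ps) => /(_ xs) /negP.
  by rewrite /= xc.
have inc x y : x \in c -> y \in c -> cycles_rel (c :: cs) x y = adjacent c x y.
  move: U; rewrite cat_uniq => /and3P[_ /hasPn d _] xs ys.
  rewrite /cycles_rel /= orbC; case: (boolP (has _ cs)) => //.
  by case/mem_cycles_rel/andP => xc; have := d x xc; rewrite /= xs.
rewrite -(spread_eq (e := cycles_rel (c :: cs))) // in hs.
move: hcs; rewrite -(perm_size ps) => hcs.
have Uc : uniq c by move: U; rewrite cat_uniq => /and3P[].
rewrite /arrangeable; move: (cycles_rel (c :: cs)) dis dis' inc hs => E dis dis' inc hs.
suff [u pu su] : exists2 u, perm_eq u (c ++ s) & spread E u.
  by exists u => //; apply: perm_trans pu _; rewrite /= perm_cat2l.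
clear same.
case: s {ps} hcs hs dis dis' => [|x1 [|x2 [|x3 [|x4 r]]]] // _ hs dis dis'.
have dr x k : x \in c -> all (fun y => ~~ E x y) (take k r).
  by move=> xc; apply/allP => y /mem_take yr; apply: dis; rewrite // !inE yr !orbT.
have [{}hs h3 h4] : [/\ [&& ~~ E x1 x2, ~~ E x1 x3, ~~ E x2 x3, ~~ E x2 x4,
     ~~ E x3 x4 & spread E r],
   all (fun y => ~~ E x3 y) (take 1 r) & all (fun y => ~~ E x4 y) (take 2 r)].
  move: hs; rewrite /= => /and5P[/and3P[-> -> _] /and3P[-> -> _] /andP[-> h] -> ->].
  by rewrite h.
(* When [c] is a triangle, its last vertex comes between [x4] and [r], so only one entry of [r]
   stays within distance 2 of [x4]. *)
have h4' : all (fun y => ~~ E x4 y) (take 1 r).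
  by case: (r) h4 => //= y u /andP[->]; rewrite take0.
have xs x : x \in [:: x1; x2; x3; x4] -> x \in [:: x1, x2, x3, x4 & r].
  by rewrite !inE => /or4P[]-> ; rewrite ?orbT.
have dx x y : x \in c -> y \in [:: x1; x2; x3; x4] -> ~~ E x y && ~~ E y x.
  by move=> xc /xs ys; rewrite dis ?dis'.
case/and5P: hs => e12 e13 e23 e24 /andP[e34 hr].
case: c hc Uc dr dx inc {U dis dis' xs} =>
  [|a [|b [|d [|f [|g [|k []]]]]]] //= _ Uc dr dx inc.
(* In each pattern, vertices of [c] at distance 1 or 2 are not neighbours on the cycle, as with the
   classes [a, d, g] and [b, f, k] of the hexagon. *)
- exists [:: a, x1, x2, b, x3, x4, d & r].
    by perm_count.
  solve_spread inc dx dr.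
- exists [:: a, d, x1, x2, b, f, x3, x4 & r].
    by perm_count.
  solve_spread inc dx dr.
- exists [:: a, d, x1, g, b, x2, f, x3, x4 & r].
    by perm_count.
  solve_spread inc dx dr.
- exists [:: a, d, g, x1, b, f, k, x2, x3, x4 & r].
    by perm_count.
  solve_spread inc dx dr.
Qed.

End Arrangements.

(** * Reduction to cycles on integers *)

Lemma links_map (T U : eqType) (h : T -> U) (c : seq T) :
  links (map h c) = [seq (h u.1, h u.2) | u <- links c].
Proof.
rewrite /links -map_rot; elim: c (rot 1 c) => [|x c IHc] [|y d] //=.
by rewrite IHc.
Qed.

Lemma mem_links_map (T U : eqType) (h : T -> U) (c d : seq T) x y :
  {subset c <= d} -> {in d &, injective h} -> x \in d -> y \in d ->
  ((h x, h y) \in links (map h c)) = ((x, y) \in links c).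
Proof.
move=> cd hinj xd yd; rewrite links_map; apply/mapP/idP => [[[a b] /= ab]|xy].
  have /andP[ac bc] := mem_links ab.
  by case=> /(hinj _ _ xd (cd _ ac)) -> /(hinj _ _ yd (cd _ bc)) ->.
by exists (x, y).
Qed.

Lemma spread_map (T : eqType) (U : eqType) (h : T -> U) (e : rel U) (s : seq T) :
  spread e (map h s) = spread (relpre h e) s.
Proof. by elim: s => //= x s ->; rewrite -map_take all_map. Qed.

(** A normal form for disjoint cycles with lengths [ks], on which [spread] can be evaluated. *)
Definition labels (ks : seq nat) : seq (seq nat) := reshape ks (iota 0 (sumn ks)).

Lemma flatten_labels ks : flatten (labels ks) = iota 0 (sumn ks).
Proof. by rewrite reshapeKr ?size_iota. Qed.

(** Arrangeability depends only on the cycle lengths: sending [i] to the entry of rank [i] in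
    [flatten cs] is injective and carries links to links. *)
Lemma arrangeable_labels (T : eqType) (cs : seq (seq T)) :
  uniq (flatten cs) -> arrangeable (labels (shape cs)) -> arrangeable cs.
Proof.
case fcs : (flatten cs) => [|x0 L]; first by move=> _ _; exists [::]; rewrite // fcs.
rewrite -fcs => U.
set h := nth x0 (flatten cs); pose n := size (flatten cs).
have csE : cs = map (map h) (labels (shape cs)).
  by rewrite map_reshape -size_flatten map_nth_iota0 // take_size flattenK.
have hinj : {in iota 0 n &, injective h}.
  by move=> i j; rewrite !mem_iota => hi hj /eqP; rewrite nth_uniq // => /eqP.
have fl : flatten (labels (shape cs)) = iota 0 n.
  by rewrite flatten_labels -size_flatten.
case=> s; rewrite fl => ps hs; exists (map h s).
  by rewrite -[flatten cs](take_size) -(map_nth_iota0 x0) // perm_map.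
rewrite spread_map (spread_eq (e' := cycles_rel (labels (shape cs)))) //.
move=> x y; rewrite !(perm_mem ps) => xs ys /=.
rewrite {1}csE /cycles_rel has_map; apply: eq_in_has => c hc /=.
have sub : {subset c <= iota 0 n}.
  by move=> z zc; rewrite -fl; apply/flattenP; exists c.
by rewrite /adjacent !(mem_links_map sub).
Qed.

Lemma arrangeable_nat (T : eqType) (cs : seq (seq T)) (s : seq nat) :
  uniq (flatten cs) -> perm_eq s (iota 0 (sumn (shape cs))) ->
  spread (cycles_rel (labels (shape cs))) s -> arrangeable cs.
Proof.
by move=> U ps hs; apply: arrangeable_labels => //; exists s; rewrite ?flatten_labels.
Qed.

Lemma links_iota k x y :
  (x, y) \in links (iota 0 k) -> (y == x.+1) || (x.+1 == k) && (y == 0).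
Proof.
case: k => // k; rewrite /links rot1_cons.
move=> /(nthP (0, 0)) [i].
have sz : size (iota 0 k.+1) = size (rcons (iota 1 k) 0) by rewrite size_rcons !size_iota.
rewrite size_zip -sz minnn size_iota => hi; rewrite nth_zip // nth_iota //.
rewrite nth_rcons size_iota; case: ltnP => hk; last first.
  have -> : i = k by lia.
  by rewrite eqxx => -[<- <-]; rewrite !eqxx orbT.
by rewrite nth_iota // => -[<- <-]; rewrite !add0n add1n eqxx.
Qed.

(** * Arranging long cycles and small families of short ones *)

Lemma arrangeable_long (T : eqType) (c : seq T) :
  uniq c -> 6 < size c -> arrangeable [:: c].
Proof.
move=> U hk; set k := size c in hk.
(* Even positions, then odd ones. Positions [2i] and [2i+1] land [uphalf k] apart, [2i+1] and [2i+2]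
   land [uphalf k - 1] apart, and the closing pair no closer; this is at least 3 once [k] is at
   least 7. *)
pose v m := if m < uphalf k then m.*2 else (m - uphalf k).*2.+1.
apply: (@arrangeable_nat _ _ (mkseq v k)); rewrite /= ?cats0 ?addn0 //.
  apply: uniq_perm; rewrite ?iota_uniq //.
    apply/mkseq_uniqP => i j; rewrite !inE /v => hi hj.
    by case: (ltnP i (uphalf k)); case: (ltnP j (uphalf k)); lia.
  move=> m; rewrite mem_iota /= add0n; apply/mapP/idP => [[i]|hm].
    by rewrite mem_iota /v => hi ->; case: (ltnP i (uphalf k)); lia.
  exists (if odd m then uphalf k + m./2 else m./2).
    by rewrite mem_iota; case: ifP; lia.
  by rewrite /v; case: (boolP (odd m)) => om; case: ltnP; lia.
apply/(spread_nth 0) => i j ij ji; rewrite size_mkseq => js.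
rewrite !nth_mkseq //; last lia.
rewrite /cycles_rel /labels /= addn0 orbF take_oversize ?size_iota // /adjacent -/k.
by apply/negP => /orP[] /links_iota; rewrite /v;
  case: (ltnP i (uphalf k)); case: (ltnP j (uphalf k)); lia.
Qed.

Lemma arrangeable_pair (T : eqType) (c1 c2 : seq T) :
  uniq (flatten [:: c1; c2]) -> 2 < size c1 <= 6 -> 2 < size c2 <= 6 ->
  7 < size c1 + size c2 -> arrangeable [:: c1; c2].
Proof.
wlog le12 : c1 c2 / size c1 <= size c2.
  move=> W; case: (leqP (size c1) (size c2)) => [/W//|/ltnW h U h1 h2 h12].
  apply: (@perm_arrangeable _ [:: c2; c1]).
    exact: (permEl (perm_catC [:: c2] [:: c1])).
  apply: W => //; last by rewrite addnC.
  by rewrite /= cats0 uniq_catC; rewrite /= cats0 in U.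
move=> U h1 h2 h12.
have R s : perm_eq s (iota 0 (sumn [:: size c1; size c2])) ->
    spread (cycles_rel (labels [:: size c1; size c2])) s -> arrangeable [:: c1; c2].
  by move=> ps hs; apply: (@arrangeable_nat _ _ s).
case: (size c1) h1 le12 h12 R => [|[|[|[|[|[|[|]]]]]]] // _;
  case: (size c2) h2 => [|[|[|[|[|[|[|]]]]]]] // _ _ _ R.
(* One list for each pair of lengths with total at least 8, in lexicographic order; both conditions
   are checked by evaluation. *)
- by apply: (R [:: 0; 3; 5; 1; 7; 4; 2; 6]).
- by apply: (R [:: 0; 3; 5; 1; 7; 4; 2; 6; 8]).
- by apply: (R [:: 0; 2; 4; 6; 1; 3; 5; 7]).
- by apply: (R [:: 0; 2; 4; 6; 1; 8; 3; 5; 7]).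
- by apply: (R [:: 0; 2; 4; 6; 1; 8; 3; 5; 7; 9]).
- by apply: (R [:: 0; 2; 5; 4; 1; 7; 9; 3; 6; 8]).
- by apply: (R [:: 0; 2; 5; 4; 1; 6; 8; 10; 3; 7; 9]).
- by apply: (R [:: 0; 2; 4; 6; 1; 3; 7; 9; 11; 5; 8; 10]).
Qed.

Lemma arrangeable_cons (T : eqType) (c : seq T) cs :
  uniq (flatten (c :: cs)) -> 2 < size c -> 3 < size (flatten cs) ->
  arrangeable cs -> arrangeable (c :: cs).
Proof.
move=> U hc hcs A; case: (leqP (size c) 6) => hc6.
  by apply: arrangeable_insert; rewrite // hc.
apply: (@arrangeable_cat _ [:: c]) => //; apply: arrangeable_long => //.
by move: U; rewrite cat_uniq => /and3P[].
Qed.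

Lemma arrangeable_extend (T : eqType) (cs' cs : seq (seq T)) :
  uniq (flatten (cs' ++ cs)) -> all (fun c => 2 < size c) cs' ->
  3 < size (flatten cs) -> arrangeable cs -> arrangeable (cs' ++ cs).
Proof.
elim: cs' => //= c cs' IHcs U /andP[hc hcs'] hcs A.
apply: arrangeable_cons => //; first by rewrite flatten_cat size_cat ltn_addl.
by apply: IHcs => //; move: U; rewrite cat_uniq => /and3P[].
Qed.

(** It suffices to arrange a subfamily with at least 4 vertices: the other cycles are then added one
    at a time. *)
Lemma arrangeable_sub (T : eqType) (cs' cs cs0 : seq (seq T)) :
  perm_eq cs (cs' ++ cs0) ->
  uniq (flatten cs) -> all (fun c => 2 < size c) cs ->
  3 < size (flatten cs0) -> (uniq (flatten cs0) -> arrangeable cs0) -> arrangeable cs.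
Proof.
move=> p U hcs h0 A; apply: (@perm_arrangeable _ (cs' ++ cs0)).
  by rewrite perm_sym.
move: U; rewrite (perm_uniq (perm_flatten p)) => U.
move: hcs; rewrite (perm_all _ p) all_cat => /andP[hcs' _].
apply: arrangeable_extend => //; apply: A.
by move: U; rewrite flatten_cat cat_uniq => /and3P[].
Qed.

Lemma arrangeable_three (T : eqType) (c1 c2 c3 : seq T) :
  uniq (flatten [:: c1; c2; c3]) -> size c1 = 3 -> size c2 = 3 ->
  3 <= size c3 <= 4 -> arrangeable [:: c1; c2; c3].
Proof.
move=> U e1 e2 h3.
have R s : perm_eq s (iota 0 (sumn [:: 3; 3; size c3])) ->
    spread (cycles_rel (labels [:: 3; 3; size c3])) s -> arrangeable [:: c1; c2; c3].
  by move=> ps hs; apply: (@arrangeable_nat _ _ s); rewrite /= ?e1 ?e2.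
case: (size c3) h3 R => [|[|[|[|[|]]]]] // _ R.
- by apply: (R [:: 0; 3; 6; 1; 4; 7; 2; 5; 8]).
- by apply: (R [:: 0; 3; 6; 1; 4; 7; 9; 2; 5; 8]).
Qed.

(** A cycle of length at least 7, or two cycles with at least 8 vertices together, can serve as the
    starting subfamily. Failing both, any two cycles have at most 7 vertices together, so among
    three cycles at least two are triangles and the third has length 3 or 4. *)
Lemma arrangeable_or_short (T : eqType) (cs : seq (seq T)) :
  uniq (flatten cs) -> all (fun c => 2 < size c) cs ->
  arrangeable cs \/
  (exists2 c, cs = [:: c] & size c <= 6) \/
  (exists c d, [/\ perm_eq cs [:: c; d], size c = 3 & size d = 3 \/ size d = 4]).
Proof.
case: cs => [|c1 cs] U hcs; first by left; exists [::].
have sz c0 : c0 \in c1 :: cs -> 2 < size c0 by move/(allP hcs).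
have one c cs' : perm_eq (c1 :: cs) (c :: cs') -> 6 < size c -> arrangeable (c1 :: cs).
  move=> p hc; apply: (arrangeable_sub (cs' := cs') (cs0 := [:: c])) => //=.
  - by rewrite (perm_trans p) // -cat1s perm_catC.
  - by rewrite cats0; lia.
  - by rewrite cats0 => Uc; apply: arrangeable_long.
have two c d cs' : perm_eq (c1 :: cs) [:: c, d & cs'] ->
    7 < size c + size d -> arrangeable (c1 :: cs).
  move=> p hcd.
  have hc : 2 < size c by apply: sz; rewrite (perm_mem p) !inE eqxx.
  have hd : 2 < size d by apply: sz; rewrite (perm_mem p) !inE eqxx orbT.
  case: (leqP (size c) 6) => hc6; last exact: one p hc6.
  case: (leqP (size d) 6) => hd6; last first.
    apply: (one d (c :: cs')) => //; apply: perm_trans p _.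
    exact: (permEl (perm_catCA [:: c] [:: d] cs')).
  apply: (arrangeable_sub (cs' := cs') (cs0 := [:: c; d])) => //=.
  - by rewrite (perm_trans p) // -[_ :: _]/([:: c; d] ++ cs') perm_catC.
  - by rewrite cats0 size_cat; lia.
  - by move=> Ucd; apply: arrangeable_pair; rewrite ?hc ?hd.
case: (leqP (size c1) 6) => hc1; last by left; apply: one hc1.
case: cs => [|c2 cs] in U hcs sz one two *; first by right; left; exists c1.
have h1 : 2 < size c1 by apply: sz; rewrite !inE eqxx.
have h2 : 2 < size c2 by apply: sz; rewrite !inE eqxx orbT.
case: (leqP (size c1 + size c2) 7) => h12; last by left; apply: two h12.
case: cs => [|c3 cs] in U hcs sz one two *.
  right; right; case: (leqP (size c1) 3) => h1'.
    by exists c1, c2; split=> //; lia.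
  exists c2, c1; split; [exact: (permEl (perm_catC [:: c1] [:: c2]))|lia|lia].
left.
have h3 : 2 < size c3 by apply: sz; rewrite !inE eqxx !orbT.
case: (leqP (size c1 + size c3) 7) => h13; last first.
  apply: (two c1 c3 (c2 :: cs)) => //; rewrite perm_cons.
  exact: (permEl (perm_catCA [:: c2] [:: c3] cs)).
case: (leqP (size c2 + size c3) 7) => h23; last first.
  apply: (two c2 c3 (c1 :: cs)) => //.
  exact: (permEl (perm_catCA [:: c1] [:: c2; c3] cs)).
have three a b c : perm_eq [:: c1; c2; c3] [:: a; b; c] -> size a = 3 -> size b = 3 ->
    3 <= size c <= 4 -> arrangeable [:: c1, c2, c3 & cs].
  move=> p ea eb ec; apply: (arrangeable_sub (cs' := cs) (cs0 := [:: a; b; c])) => //=.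
  - by rewrite -[X in perm_eq X]/([:: c1; c2; c3] ++ cs) perm_catC perm_cat2l.
  - by rewrite cats0 !size_cat; lia.
  - by move=> Ucd; apply: arrangeable_three.
(* At most one of the first three cycles has length 4; it is moved to the last place. *)
case: (leqP (size c1) 3) => h1'; last first.
  apply: (three c2 c3 c1); try lia; exact: (permEl (perm_catC [:: c1] [:: c2; c3])).
case: (leqP (size c2) 3) => h2'; last first.
  apply: (three c1 c3 c2); try lia.
  by rewrite perm_cons; exact: (permEl (perm_catC [:: c2] [:: c3])).
by apply: (three c1 c2 c3) => //; lia.
Qed.

(** * Decomposition of a 2-regular graph into cycles *)

Lemma uniq_size_card (V : finType) (s : seq V) : uniq s -> size s <= #|V|.
Proof. by move=> /card_uniqP <-; apply: max_card. Qed.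

Section Decomposition.

Variables (V : finType) (e : rel V).
Hypotheses (symE : symmetric e) (irrE : irreflexive e) (regE : regular 2 e).

Lemma other_neighbor x y : exists2 z, e x z & z != y.
Proof.
have /card_gt0P [z] : 0 < #|[set w | e x w] :\ y|.
  by have := cardsD1 y [set w | e x w]; rewrite regE; lia.
by rewrite !inE => /andP[zy exz]; exists z.
Qed.

(* A path that never turns back ends up hitting itself. *)
Lemma exists_cycle (A : pred V) x :
  (forall a b, A a -> e a b -> A b) -> A x ->
  exists c, [/\ uniq c, cycle e c, 2 < size c & all A c].
Proof.
move=> Acl Ax.
(* The path is kept newest vertex first, with [x] its current end. At [m = 0] it would have more
   than [#|V|] distinct vertices. *)
suff [m] : exists m, #|V| < m + size [:: x].
  have : all A [:: x] by rewrite /= Ax.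
  have : path e x [::] by [].
  have : uniq [:: x] by [].
  elim: m x [::] {Ax} => [|m IHm] x s U P As.
    by have := uniq_size_card U; lia.
  (* [head x s] is the vertex visited just before [x]; on a one-vertex path it defaults to [x],
     which is never a neighbour of itself. *)
  move=> hm; have [z exz zs] := other_neighbor x (head x s).
  have zx : z != x by apply: contraTneq exz => ->; rewrite irrE.
  have [zin|zin] := boolP (z \in s); last first.
    apply: (IHm z (x :: s)); rewrite /= ?inE ?negb_or ?zx ?zin //.
    - by rewrite symE exz.
    - by rewrite (Acl x z) //; case/andP: As.
    - by move: hm; rewrite /=; lia.
  (* Cutting the path at [z] leaves a cycle, of length at least 3 because [z] is not the vertex
     visited just before [x]. *)
  case/splitPr: zin zs U P As {hm} => s1 s2 zs U P As.
  exists (x :: rcons s1 z).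
  move: U; rewrite -cat_rcons -cat_cons cat_uniq => /and3P[U _ _].
  move: P; rewrite -cat_rcons cat_path => /andP[P _].
  move: As; rewrite -cat_rcons -cat_cons all_cat => /andP[As _].
  split=> //; first by rewrite (cycle_path x) /= last_rcons symE exz.
  by case: s1 zs {U P As} => [|y s1] /=; rewrite ?eqxx // size_rcons.
by exists #|V|; rewrite addn1.
Qed.

Lemma path_links (T : eqType) (r : rel T) x (s : seq T) y :
  path r x (rcons s y) = all (fun u => r u.1 u.2) (zip (x :: s) (rcons s y)).
Proof. by elim: s x => [|z s IHs] x //=; rewrite IHs. Qed.

Lemma cycle_links (T : eqType) (r : rel T) (c : seq T) :
  cycle r c = all (fun u => r u.1 u.2) (links c).
Proof. by case: c => // x c; rewrite /links rot1_cons -path_links. Qed.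

Lemma neighbor_cases x y z w : y != z -> e x y -> e x z -> e x w -> (w == y) || (w == z).
Proof.
move=> yz exy exz exw; have : [set y; z] == [set w | e x w].
  rewrite eqEcard regE cards2 yz andbT; apply/subsetP => t.
  by rewrite !inE => /orP[/eqP->|/eqP->].
by move/eqP/setP => /(_ w); rewrite !inE exw.
Qed.

Lemma links_cat (T : eqType) x y (s1 s2 : seq T) :
  links ((x :: s1) ++ (y :: s2)) =
  zip (x :: s1) (rcons s1 y) ++ zip (y :: s2) (rcons s2 x).
Proof.
by rewrite /links cat_cons rot1_cons rcons_cat rcons_cons
  -[s1 ++ y :: rcons _ _]cat_rcons -cat_cons zip_cat //= size_rcons.
Qed.

Lemma links_rot (T : eqType) i (c : seq T) : links (rot i c) =i links c.
Proof.
move=> u; rewrite -{2}(cat_take_drop i c) /rot.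
case: (take i c) (drop i c) => [|x s1] [|y s2]; rewrite ?cats0 //.
by rewrite !links_cat !mem_cat orbC.
Qed.

(** Length at least 3 makes the successor and the predecessor of [x] on [c] distinct, so by
    2-regularity [x] has no other neighbour. *)
Lemma cycle_adjacent c x w : uniq c -> cycle e c -> 2 < size c -> x \in c ->
  e x w = adjacent c x w.
Proof.
move=> U C hc xc.
have lE y z : (y, z) \in links c -> e y z.
  by move: C; rewrite cycle_links => /allP C /C.
apply/idP/idP; last by case/orP=> /lE //; rewrite symE.
case: (rot_to xc) => i c' hr; rewrite /adjacent -!(links_rot i c) hr.
have {}lE y z : (y, z) \in links (x :: c') -> e y z by rewrite -hr links_rot; apply: lE.
move: U hc; rewrite -(rot_uniq i) -(size_rot i) hr.
case: c' hr lE => // y c'; case: (lastP c') => // c'' z _ lE /andP[_ U] _.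
have yz : y != z.
  by case/andP: U => + _; apply: contraNneq => ->; rewrite mem_rcons inE eqxx.
have xy : (x, y) \in links [:: x, y & rcons c'' z] by rewrite /links rot1_cons inE eqxx.
have zx : (z, x) \in links [:: x, y & rcons c'' z].
  rewrite /links rot1_cons -!rcons_cons zip_rcons ?mem_rcons ?inE ?eqxx //.
  by rewrite /= !size_rcons.
move=> exw; case/orP: (neighbor_cases yz (lE _ _ xy) (etrans (symE _ _) (lE _ _ zx)) exw).
  by move=> /eqP ->; rewrite xy.
by move=> /eqP ->; rewrite zx orbT.
Qed.

(** Cycles are peeled off one at a time. Covered vertices have all their edges inside the chosen
    cycles, so the uncovered ones are closed under [e] and contain a further cycle. *)
Lemma cycle_decomposition : exists cs : seq (seq V),
  [/\ uniq (flatten cs), flatten cs =i predT, all (fun c => 2 < size c) cs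
    & e =2 cycles_rel cs].
Proof.
suff H m cs : #|V| < m + size (flatten cs) ->
    uniq (flatten cs) -> all (fun c => 2 < size c) cs ->
    (forall x y, x \in flatten cs -> e x y = cycles_rel cs x y) ->
  exists cs : seq (seq V),
  [/\ uniq (flatten cs), flatten cs =i predT, all (fun c => 2 < size c) cs
    & e =2 cycles_rel cs].
  by apply: (H #|V|.+1 [::]); rewrite ?addn0.
elim: m cs => [|m IHm] cs hm U hcs ecs.
  by move: hm; rewrite ltnNge uniq_size_card.
have [/existsP[x hx]|] := boolP [exists x, x \notin flatten cs]; last first.
  rewrite negb_exists => /forallP h; exists cs; split=> //.
    by move=> x; have := h x; rewrite negbK => ->.
  by move=> x y; apply: ecs; have := h x; rewrite negbK.
have Acl a b : a \notin flatten cs -> e a b -> b \notin flatten cs.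
  move=> na; rewrite symE; apply: contraL => bf; rewrite ecs //; apply: contraNN na.
  by case/mem_cycles_rel/andP.
have [c [Uc Cc hc Ac]] := exists_cycle Acl hx.
apply: (IHm (c :: cs)) => /=.
- rewrite size_cat addnA (leq_trans hm) // leq_add2r -addn1 leq_add2l.
  exact: ltnW (ltnW hc).
- rewrite cat_uniq Uc U andbT; apply/hasPn => y yf; apply/negP => yc.
  by have := allP Ac y yc; rewrite /= yf.
- by rewrite hc.
move=> y z; rewrite mem_cat => /orP[yc|yf].
  rewrite (cycle_adjacent z Uc) // /cycles_rel /= orbC.
  case: (boolP (has _ _)) => // /mem_cycles_rel/andP[yf _].
  by have := allP Ac y yc; rewrite /= yf.
rewrite ecs //; case: (boolP (adjacent c y z)) => //.
by case/mem_adjacent/andP=> yc _; have := allP Ac y yc; rewrite /= yf.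
Qed.

End Decomposition.

(** * Isomorphisms with one or two standard cycles *)

Lemma nth_rot1 (T : eqType) (x0 : T) (c : seq T) i : i < size c ->
  nth x0 (rot 1 c) i = nth x0 c (i.+1 %% size c).
Proof.
case: c => // x c /= ic; rewrite rot1_cons nth_rcons; case: ltnP => hi.
  by rewrite modn_small.
by rewrite (_ : i = size c) ?eqxx ?modnn //=; lia.
Qed.

Lemma mem_links_nth (T : eqType) (x0 : T) (c : seq T) i j :
  uniq c -> i < size c -> j < size c ->
  ((nth x0 c i, nth x0 c j) \in links c) = (j == i.+1 %% size c).
Proof.
move=> U ic jc; have sz : size c = size (rot 1 c) by rewrite size_rot.
have mc : i.+1 %% size c < size c by rewrite ltn_mod; lia.
have E : nth (x0, x0) (links c) i = (nth x0 c i, nth x0 c (i.+1 %% size c)).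
  by rewrite nth_zip // nth_rot1.
have szl : size (links c) = size c by rewrite size_zip -sz minnn.
apply/idP/eqP => [|->]; last by rewrite -E mem_nth ?szl.
case/(nthP (x0, x0)) => m; rewrite szl => hm; rewrite nth_zip // nth_rot1 //.
have mm : m.+1 %% size c < size c by rewrite ltn_mod; lia.
by case=> /eqP + /eqP; rewrite !nth_uniq // => /eqP -> /eqP ->.
Qed.

Lemma adjacent_nth (T : eqType) (x0 : T) (c : seq T) (i j : 'I_(size c)) :
  uniq c -> adjacent c (nth x0 c i) (nth x0 c j) = cycle_graph i j.
Proof. by move=> U; rewrite /adjacent !mem_links_nth. Qed.

Lemma isomorphic_inj (V W : finType) (e : rel V) (e' : rel W) (g : W -> V) :
  injective g -> #|V| <= #|W| -> (forall u v, e (g u) (g v) = e' u v) ->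
  isomorphic e e'.
Proof.
move=> g_inj card ge; case: (inj_card_bij g_inj card) => f gK fK.
by exists f; split=> [|x y]; [exists g|rewrite -ge !fK].
Qed.

Lemma card_flatten (V : finType) (cs : seq (seq V)) :
  uniq (flatten cs) -> flatten cs =i predT -> #|V| = size (flatten cs).
Proof. by move=> /card_uniqP <- /eq_card ->. Qed.

Lemma isomorphic_cycle (V : finType) (e : rel V) (c : seq V) :
  0 < size c ->
  uniq (flatten [:: c]) -> flatten [:: c] =i predT -> e =2 cycles_rel [:: c] ->
  isomorphic e (@cycle_graph (size c)).
Proof.
move=> c0 U full ec; have cardV := card_flatten U full.
rewrite /= cats0 in U cardV; case: c => // [x0 c'] in c0 U cardV full ec *.
set c := x0 :: c' in U cardV ec *.
apply: (@isomorphic_inj _ _ _ _ (fun i : 'I_(size c) => nth x0 c i)).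
- by move=> i j /eqP; rewrite nth_uniq // => /eqP /val_inj.
- by rewrite cardV card_ord.
- by move=> i j; rewrite ec /cycles_rel /= orbF adjacent_nth.
Qed.

Lemma isomorphic_two_cycles (V : finType) (e : rel V) (c d : seq V) :
  0 < size c ->
  uniq (flatten [:: c; d]) -> flatten [:: c; d] =i predT -> e =2 cycles_rel [:: c; d] ->
  isomorphic e (disjoint_union (@cycle_graph (size c)) (@cycle_graph (size d))).
Proof.
move=> c0 U full ec; have cardV := card_flatten U full.
rewrite /= cats0 in U cardV; case: c => // [x0 c'] in c0 U cardV full ec *.
set c := x0 :: c' in U cardV ec *.
move: (U); rewrite cat_uniq => /and3P[Uc /hasPn dis Ud].
have sep (i : 'I_(size c)) (j : 'I_(size d)) : nth x0 c i \in d = false.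
  by apply/negP => /dis; rewrite /= mem_nth.
pose g (u : 'I_(size c) + 'I_(size d)) :=
  match u with inl i => nth x0 c i | inr j => nth x0 d j end.
have sepa (i : 'I_(size c)) (j : 'I_(size d)) :
    adjacent c (nth x0 c i) (nth x0 d j) = false /\
    adjacent d (nth x0 c i) (nth x0 d j) = false.
  split; apply/negP => /mem_adjacent/andP[]; last by rewrite (sep i j).
  by move=> _; apply/negP/dis/mem_nth.
apply: (@isomorphic_inj _ _ _ _ g).
- case=> i [] j //= h.
  + by move/eqP: h; rewrite nth_uniq // => /eqP /val_inj ->.
  + by have := sep i j; rewrite h mem_nth.
  + by have := sep j i; rewrite -h mem_nth.
  + by move/eqP: h; rewrite nth_uniq // => /eqP /val_inj ->.
- by rewrite cardV size_cat card_sum !card_ord.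
case=> i [] j; rewrite ec /cycles_rel /= orbF.
- rewrite adjacent_nth // orbC; case: (boolP (adjacent d _ _)) => //.
  by case/mem_adjacent/andP=> h; have := dis _ h; rewrite /= mem_nth.
- by case: (sepa i j) => -> ->.
- by rewrite !(adjacentC _ (nth x0 d i)); case: (sepa j i) => -> ->.
- rewrite (adjacent_nth x0 i j Ud); case: (boolP (adjacent c _ _)) => //.
  by case/mem_adjacent/andP=> h _; have /negP[] := dis _ (mem_nth x0 (ltn_ord i)).
Qed.

(** * Points in convex position *)

Section Orientation.

Import Order.TTheory GRing.Theory Num.Theory.
Local Open Scope ring_scope.

Variable R : realType.
Implicit Types a b c d : 'rV[R]_2.

(** Twice the signed area of the triangle [a b c], positive when it is counterclockwise. *)
Definition orient a b c : R :=
  (b 0 0 - a 0 0) * (c 0 1 - a 0 1) - (b 0 1 - a 0 1) * (c 0 0 - a 0 0).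

Lemma row2P a b : a 0 0 = b 0 0 -> a 0 1 = b 0 1 -> a = b.
Proof.
move=> h0 h1; apply/rowP => i.
have /orP[/eqP ->|/eqP ->] // : (i == 0) || (i == 1).
by case: i => [[|[|//]] h].
Qed.

Lemma orientC a b c : orient a b c = - orient a c b.
Proof. by rewrite /orient; ring. Qed.

Lemma orient_rot a b c : orient a b c = orient b c a.
Proof. by rewrite /orient; ring. Qed.

Lemma orient_seg a b c d t :
  orient a b ((1 - t) *: c + t *: d) = (1 - t) * orient a b c + t * orient a b d.
Proof. by rewrite /orient !mxE; ring. Qed.

Variables (n : nat) (p : 'I_n -> 'rV[R]_2).
Hypothesis convP : convex_position p.

(** The working form of convex position: weights need not be normalised, and [a], [b], [c] may
    coincide, so combinations of fewer points are covered too. *)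
Lemma not_combination (i a b c : 'I_n) (x y z : R) : a != i -> b != i -> c != i ->
  0 <= x -> 0 <= y -> 0 <= z -> 0 < x + y + z ->
  x * p a 0 0 + y * p b 0 0 + z * p c 0 0 = (x + y + z) * p i 0 0 ->
  x * p a 0 1 + y * p b 0 1 + z * p c 0 1 = (x + y + z) * p i 0 1 -> False.
Proof.
move=> ai bi ci x0 y0 z0 S0 e0 e1; set S := x + y + z in S0 e0 e1.
have Sn0 : S != 0 by rewrite gt_eqF.
have sumE (V : lmodType R) (v : 'I_n -> V) k (t : R) : k != i ->
    \sum_(j | j != i) ((j == k)%:R * t) *: v j = t *: v k.
  move=> ki; rewrite (bigD1 k) //= eqxx mul1r big1 ?addr0 // => j /andP[_ /negbTE ->].
  by rewrite mul0r scale0r.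
(* A sum of indicators, so that weights add up when points coincide. *)
pose w j := (j == a)%:R * (x / S) + (j == b)%:R * (y / S) + (j == c)%:R * (z / S).
have wE (V : lmodType R) (v : 'I_n -> V) :
    \sum_(j | j != i) w j *: v j = (x / S) *: v a + (y / S) *: v b + (z / S) *: v c.
  by under eq_bigr do rewrite /w !scalerDl; rewrite !big_split /= !sumE.
apply: (convP (i := i)); exists w; split.
- by move=> j; rewrite /w !addr_ge0 // mulr_ge0 ?divr_ge0 ?ler0n // ltW.
(* The total weight is the combination of the constant function 1. *)
- have := wE R^o (fun=> 1); under eq_bigr do rewrite /GRing.scale /= mulr1.
  by move=> ->; rewrite /GRing.scale /= !mulr1 -!mulrDl divff.
- rewrite wE; apply: row2P; rewrite !mxE; apply: (mulfI Sn0); rewrite -?e0 -?e1; field.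
  by [].
  by [].
Qed.

Lemma convex_inj : injective p.
Proof.
move=> i j pij; apply/eqP/negPn/negP => ij.
apply: (@not_combination i j j j 1 0 0); rewrite ?pij 1?eq_sym //; lra.
Qed.

Lemma sqr_dist_gt0 i j : i != j ->
  0 < (p j 0 0 - p i 0 0) ^+ 2 + (p j 0 1 - p i 0 1) ^+ 2.
Proof.
move=> ij; rewrite lt_def addr_ge0 ?sqr_ge0 // andbT paddr_eq0 ?sqr_ge0 //.
rewrite !sqrf_eq0 !subr_eq0; apply: contra ij => /andP[/eqP h0 /eqP h1].
by rewrite eq_sym; apply/eqP/convex_inj/row2P.
Qed.

(** Of three collinear points one lies between the others. Here [d / D] is the coordinate of [p k]
    on the line with [p i] at 0 and [p j] at 1; the cases [d < 0], [D < d] and the remaining one put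
    [p i], [p j] and [p k] in the middle, respectively. *)
Lemma orient_neq0 i j k : i != j -> i != k -> j != k ->
  orient (p i) (p j) (p k) != 0.
Proof.
move=> ij ik jk; apply/eqP => o0; have := sqr_dist_gt0 ij; have := sqr_dist_gt0 ik.
move: o0; rewrite /orient.
set u0 := p j 0 0 - p i 0 0; set u1 := p j 0 1 - p i 0 1.
set v0 := p k 0 0 - p i 0 0; set v1 := p k 0 1 - p i 0 1 => o0.
set E := v0 ^+ 2 + v1 ^+ 2; set D := u0 ^+ 2 + u1 ^+ 2 => E0 D0.
pose d := u0 * v0 + u1 * v1.
have h0 : D * v0 = d * u0.
  by apply/eqP; rewrite -subr_eq0 -[X in _ == X](mulr0 (- u1)) -o0 /D /d; apply/eqP; ring.
have h1 : D * v1 = d * u1.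
  by apply/eqP; rewrite -subr_eq0 -[X in _ == X](mulr0 u0) -o0 /D /d; apply/eqP; ring.
move: h0 h1 D0; rewrite /u0 /u1 /v0 /v1; clearbody D d => h0 h1 D0.
clear u0 u1 v0 v1 o0 E E0.
have [ji ki kj] : [/\ j != i, k != i & k != j] by split; rewrite eq_sym.
have [d0|d0] := ltP d 0.
  by apply: (@not_combination i j k k (- d) D 0) => //; lra.
have [dD|dD] := ltP D d.
  by apply: (@not_combination j i k k (d - D) D 0) => //; lra.
by apply: (@not_combination k i j j (D - d) d 0) => //; lra.
Qed.

(** Otherwise [p o] would lie in the triangle of the other three points, with the orientations as
    unnormalised barycentric coordinates. *)
Lemma orient_trans o i j k : i != o -> j != o -> k != o -> i != k ->
  0 < orient (p o) (p i) (p j) -> 0 < orient (p o) (p j) (p k) ->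
  0 < orient (p o) (p i) (p k).
Proof.
move=> io jo ko ik h1 h2.
have n0 : orient (p o) (p i) (p k) != 0 by apply: orient_neq0; rewrite // eq_sym.
rewrite lt_def n0 leNgt; apply/negP => h3.
apply: (@not_combination o i j k (orient (p o) (p j) (p k)) (- orient (p o) (p i) (p k))
  (orient (p o) (p i) (p j))) => //; try lra.
- by rewrite /orient; ring.
- by rewrite /orient; ring.
Qed.

(** Otherwise [p j] would lie in the triangle of [p o], [p i] and [p k]. *)
Lemma orient_outer o i j k : o != j -> i != j -> k != j -> i != k ->
  0 < orient (p o) (p i) (p j) -> 0 < orient (p o) (p j) (p k) ->
  0 < orient (p o) (p i) (p k) -> 0 < orient (p i) (p j) (p k).
Proof.
move=> oj ij kj ik h1 h2 h3.
have n0 : orient (p i) (p j) (p k) != 0 by apply: orient_neq0; rewrite // eq_sym.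
rewrite lt_def n0 leNgt; apply/negP => h4.
have h5 : orient (p o) (p i) (p k) =
  - orient (p i) (p j) (p k) + orient (p o) (p j) (p k) + orient (p o) (p i) (p j).
  by rewrite /orient; ring.
apply: (@not_combination j o i k (- orient (p i) (p j) (p k)) (orient (p o) (p j) (p k))
  (orient (p o) (p i) (p j))) => //; try lra.
- by rewrite /orient; ring.
- by rewrite /orient; ring.
Qed.

End Orientation.

(** * Counterclockwise labelling and supporting lines *)

Section CyclicOrder.

Import Order.TTheory GRing.Theory Num.Theory.
Local Open Scope ring_scope.

Variable R : realType.

Definition ccw (n : nat) (q : 'I_n -> 'rV[R]_2) : Prop :=
  forall i j k : 'I_n, (i < j)%N -> (j < k)%N -> 0 < orient (q i) (q j) (q k).

(* Sort the points by angle around one of them. *)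
Lemma cyclic_order (n : nat) (p : 'I_n -> 'rV[R]_2) :
  convex_position p -> exists2 s : 'I_n -> 'I_n, injective s & ccw (p \o s).
Proof.
case: n p => [|n] p convP; first by exists id => // -[].
pose o : 'I_n.+1 := ord0.
(* The pivot [o] comes first, the others by angle around it; the order is total by [orient_neq0] and
   transitive by [orient_trans]. *)
pose le x y := (x == o) || (y != o) && ((x == y) || (0 < orient (p o) (p x) (p y))).
have le_total : total le.
  move=> x y; rewrite /le; case: (eqVneq x o) => //= xo; case: (eqVneq y o) => //= yo.
  rewrite (eq_sym y x); case: (eqVneq x y) => //= xy.
  rewrite orientC oppr_gt0 -neq_lt orient_neq0 // eq_sym //.
have le_trans : transitive le.
  move=> y x z; rewrite /le; case: (eqVneq x o) => //= xo /andP[yo] /=.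
  rewrite (negbTE yo) /= => hxy /andP[zo hyz]; rewrite zo /=.
  case/orP: hxy => [/eqP -> //|hxy].
  case/orP: hyz => [/eqP <-|hyz]; first by rewrite hxy orbT.
  case: (eqVneq x z) => //= xz; exact: orient_trans hxy hyz.
pose l := sort le (enum 'I_n.+1).
have sl : size l = n.+1 by rewrite size_sort size_enum_ord.
have ul : uniq l by rewrite sort_uniq enum_uniq.
pose s (i : 'I_n.+1) := nth o l i.
have s_inj : injective s.
  by move=> i j /eqP; rewrite nth_uniq ?sl // => /eqP /val_inj.
have s_lt (i j : 'I_n.+1) : (i < j)%N ->
    s j != o /\ (s i != o -> 0 < orient (p o) (p (s i)) (p (s j))).
  move=> ij; have nij : s i != s j.
    by apply: contraTneq ij => /s_inj ->; rewrite ltnn.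
  have : le (s i) (s j).
    by apply: (sorted_ltn_nth le_trans o (sort_sorted le_total _)); rewrite // inE sl.
  rewrite /le (negbTE nij) /=; case: (eqVneq (s i) o) => [sio|nio] /=.
    by rewrite -sio eq_sym nij.
  by case/andP.
exists s => // i j k ij jk /=.
have [jo hij] := s_lt i j ij; have [ko hjk] := s_lt j k jk.
have [_ hik] := s_lt i k (ltn_trans ij jk).
case: (eqVneq (s i) o) => [->|io]; first exact: hjk.
have neq (a b : 'I_n.+1) : (a < b)%N -> s a != s b.
  by move=> ab; apply: contraTneq ab => /s_inj ->; rewrite ltnn.
apply: (orient_outer convP (o := o)); rewrite ?hij ?hjk ?hik //.
- by rewrite eq_sym.
- exact: neq.
- by rewrite eq_sym neq.
- exact/neq/(ltn_trans ij).
Qed.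

Lemma mulmx_row2 (x : 'rV[R]_2) (u : 'cV[R]_2) :
  (x *m u) 0 0 = x 0 0 * u 0 0 + x 0 1 * u 1 0.
Proof.
rewrite mxE !big_ord_recl big_ord0 addr0.
by rewrite (_ : lift ord0 ord0 = 1) //; apply: val_inj.
Qed.

(** Taking [u] normal to the line through [a] and [b] turns orientation tests into the supporting
    lines of [boundary_edge]. *)
Lemma orient_affine (a b : 'rV[R]_2) : exists (u : 'cV[R]_2) (c : R),
  forall x, (x *m u) 0 0 = c + orient a b x.
Proof.
exists (\col_i if i == 0 then a 0 1 - b 0 1 else b 0 0 - a 0 0).
exists (a 0 0 * (a 0 1 - b 0 1) + a 0 1 * (b 0 0 - a 0 0)) => x.
by rewrite mulmx_row2 !mxE /= /orient; ring.
Qed.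

Lemma boundary_edgeC (n : nat) (p : 'I_n -> 'rV[R]_2) i j :
  boundary_edge p i j -> boundary_edge p j i.
Proof. by rewrite /boundary_edge eq_sym setUC. Qed.

Lemma boundary_edge_side (n : nat) (p : 'I_n -> 'rV[R]_2) i j : i != j ->
  (forall k, k != i -> k != j -> orient (p i) (p j) (p k) < 0) ->
  boundary_edge p i j.
Proof.
move=> ij neg; split=> //; have [u [c hu]] := orient_affine (p i) (p j).
exists u, c => k; rewrite hu !inE.
have [->|ki] := eqVneq k i.
  by rewrite (_ : orient _ _ _ = 0) ?addr0 /=; [split; rewrite ?eqxx|rewrite /orient; ring].
have [->|kj] := eqVneq k j.
  by rewrite (_ : orient _ _ _ = 0) ?addr0 /=; [split; rewrite ?eqxx|rewrite /orient; ring].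
have := neg k ki kj; split; first by lra.
by apply/negbTE; rewrite lt_eqF //; lra.
Qed.

Lemma open_segmentC (a b x : 'rV[R]_2) : open_segment a b x -> open_segment b a x.
Proof.
case=> t [ht ->]; exists (1 - t); split; first lra.
by rewrite addrC opprB addrCA subrr addr0.
Qed.

Lemma segments_crossCl (a b c d : 'rV[R]_2) :
  segments_cross a b c d -> segments_cross b a c d.
Proof. by case=> x [/open_segmentC h1 h2]; exists x. Qed.

Lemma segments_crossCr (a b c d : 'rV[R]_2) :
  segments_cross a b c d -> segments_cross a b d c.
Proof. by case=> x [h1 /open_segmentC h2]; exists x. Qed.

(** * Sides and crossing chords of a counterclockwise polygon *)

Section Polygon.

Variables (n : nat) (q : 'I_n -> 'rV[R]_2).
Hypothesis ccwq : ccw q.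
Implicit Types i j k l : 'I_n.

Lemma orient_inside i k j : (i < k)%N -> (k < j)%N -> orient (q i) (q j) (q k) < 0.
Proof. by move=> ik kj; rewrite orientC oppr_lt0; apply: ccwq. Qed.

Lemma orient_outside i j k : (i < j)%N -> (k < i)%N || (j < k)%N ->
  0 < orient (q i) (q j) (q k).
Proof. by move=> ij /orP[ki|jk]; [rewrite -orient_rot|]; apply: ccwq. Qed.

Lemma orient_end i j : orient (q i) (q j) (q i) = 0 /\ orient (q i) (q j) (q j) = 0.
Proof. by split; rewrite /orient; ring. Qed.

Lemma cross_interleaved i k j l : (i < k)%N -> (k < j)%N -> (j < l)%N ->
  segments_cross (q i) (q j) (q k) (q l).
Proof.
move=> ik kj jl.
have hk := orient_inside ik kj.
have hl : 0 < orient (q i) (q j) (q l) by apply: orient_outside; [lia|rewrite jl orbT].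
have hi : 0 < orient (q k) (q l) (q i) by apply: orient_outside; [lia|rewrite ik].
have hj := orient_inside kj jl.
set ok := orient (q i) (q j) (q k) in hk; set ol := orient (q i) (q j) (q l) in hl.
set oi := orient (q k) (q l) (q i) in hi; set oj := orient (q k) (q l) (q j) in hj.
(* Both sides are the cross product of the chord directions; dividing by it gives the parameters
   [oi / (ol - ok)] and [- ok / (ol - ok)] of the common point. *)
have D : ol - ok = oi - oj by rewrite /ol /ok /oi /oj /orient; ring.
have D0 : 0 < ol - ok by lra.
have Dn : ol - ok != 0 by rewrite gt_eqF.
have e0 : (ol - ok - oi) * q i 0 0 + oi * q j 0 0 = ol * q k 0 0 - ok * q l 0 0.
  by rewrite /ol /ok /oi /orient; ring.
have e1 : (ol - ok - oi) * q i 0 1 + oi * q j 0 1 = ol * q k 0 1 - ok * q l 0 1.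
  by rewrite /ol /ok /oi /orient; ring.
clearbody ol ok oi oj.
exists ((1 - oi / (ol - ok)) *: q i + (oi / (ol - ok)) *: q j); split.
  by exists (oi / (ol - ok)); rewrite divr_gt0 // ltr_pdivrMr // mul1r; split=> //; lra.
exists (- ok / (ol - ok)); split.
  by rewrite divr_gt0 ?ltr_pdivrMr // ?mul1r; lra.
apply: row2P; rewrite !mxE; apply: (mulfI Dn).
- apply: etrans (etrans _ e0) _; [by field|by field].
- apply: etrans (etrans _ e1) _; [by field|by field].
Qed.

(** The points [q k] and [q l] are weakly on one side of the line through [q i] and [q j], and not
    both on it, so no interior point of their segment is on that line. *)
Lemma no_cross_nested i j k l : (i < j)%N -> (k < l)%N -> (i != k :> nat) || (j != l :> nat) ->
  ~~ [&& i < k, k < j & j < l]%N -> ~~ [&& k < i, i < l & l < j]%N ->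
  ~ segments_cross (q i) (q j) (q k) (q l).
Proof.
move=> ij kl neq h1 h2 [x [[t [ht xij]] [r [hr xkl]]]].
have : orient (q i) (q j) x = 0.
  by rewrite xij orient_seg; have [-> ->] := orient_end i j; rewrite !mulr0 addr0.
rewrite xkl orient_seg; set ok := orient _ _ _; set ol := orient _ _ _ => e.
have side (m : 'I_n) : [\/ (m = i :> nat \/ m = j :> nat) /\ orient (q i) (q j) (q m) = 0,
    (i < m < j)%N /\ orient (q i) (q j) (q m) < 0
    | ((m < i) || (j < m))%N /\ 0 < orient (q i) (q j) (q m)].
  have [ei ej] := orient_end i j.
  case: (ltngtP m i) => [mi|im|/val_inj ->]; last by constructor 1; split; [left|].
    by constructor 3; rewrite orient_outside ?mi.
  case: (ltngtP m j) => [mj|jm|/val_inj ->]; last by constructor 1; split; [right|].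
    by constructor 2; rewrite orient_inside.
  by constructor 3; rewrite orient_outside ?jm ?orbT.
have [hk hl] := (side k, side l); rewrite -/ok -/ol in hk hl.
case: hk => -[pk ok0]; case: hl => -[pl ol0]; try by [lia]; try nra.
Qed.

Lemma boundary_edge_consecutive i j : (i < j)%N -> boundary_edge q i j ->
  (j == i.+1 :> nat) || (i == 0 :> nat)%N && (j == n.-1 :> nat).
Proof.
move=> ij [_ [u [c hu]]]; apply/negPn/negP => nc.
have nlt : (i.+1 < n)%N by rewrite (leq_ltn_trans ij).
pose k := Ordinal nlt.
(* The label 0 serves if [i] is positive, and [n.-1] otherwise. *)
have [l hl] : exists l, (l < i)%N || (j < l)%N.
  have [i0|i0] := posnP i; last first.
    by exists (Ordinal (ltn_trans i0 (ltn_ord i))); rewrite /= i0.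
  have n1 : (n.-1 < n)%N by have := ltn_ord i; lia.
  exists (Ordinal n1); apply/orP; right => /=; have := ltn_ord j.
  by move: nc; rewrite i0 /=; lia.
have ik : (i < k)%N by [].
have kj : (k < j)%N by move: nc => /=; lia.
have lt_c m : m != i -> m != j -> (q m *m u) 0 0 < c.
  by move=> mi mj; have [h1 h2] := hu m; rewrite lt_neqAle h1 h2 !inE negb_or mi mj.
have eq_c m : m \in [set i; j] -> (q m *m u) 0 0 = c.
  by move=> hm; have [h1 h2] := hu m; apply/eqP; rewrite h2.
have hi : (q i *m u) 0 0 = c by apply: eq_c; rewrite !inE eqxx.
have hj : (q j *m u) 0 0 = c by apply: eq_c; rewrite !inE eqxx orbT.
have hk : (q k *m u) 0 0 < c by apply: lt_c; rewrite -val_eqE /=; lia.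
have {}lt_cl : (q l *m u) 0 0 < c by apply: lt_c; rewrite -val_eqE /=; lia.
have ok := orient_inside ik kj; have ol := orient_outside ij hl.
(* An affine function vanishing at q i and q j is a multiple of
   orient (q i) (q j), which has opposite signs at q k and q l. *)
have key : ((q k *m u) 0 0 - c) * orient (q i) (q j) (q l) =
    ((q l *m u) 0 0 - c) * orient (q i) (q j) (q k).
  have : ((q k *m u) 0 0 - (q i *m u) 0 0) * orient (q i) (q j) (q l) -
    ((q l *m u) 0 0 - (q i *m u) 0 0) * orient (q i) (q j) (q k) =
    ((q j *m u) 0 0 - (q i *m u) 0 0) * orient (q i) (q k) (q l).
    by rewrite !mulmx_row2 /orient; ring.
  by rewrite hi hj subrr mul0r => /eqP; rewrite subr_eq0 => /eqP.
have : ((q k *m u) 0 0 - c) * orient (q i) (q j) (q l) < 0 by nra.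
have : 0 < ((q l *m u) 0 0 - c) * orient (q i) (q j) (q k) by nra.
lra.
Qed.

Lemma consecutive_boundary_edge i j : (i < j)%N ->
  (j == i.+1 :> nat) || (i == 0 :> nat)%N && (j == n.-1 :> nat) -> boundary_edge q i j.
Proof.
move=> ij /orP[/eqP ji|/andP[/eqP i0 /eqP jn]].
  (* All other vertices are to the left of this side; reversing it makes their orientations
     negative. *)
  apply: boundary_edgeC; apply: boundary_edge_side; first by rewrite -val_eqE /=; lia.
  move=> k; rewrite -!val_eqE /= => kj ki.
  rewrite orientC -orient_rot oppr_lt0; apply: orient_outside => //; lia.
apply: boundary_edge_side; first by rewrite -val_eqE /=; lia.
move=> k; rewrite -!val_eqE /= => ki kj; have := ltn_ord k.
by move=> kn; apply: orient_inside; lia.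
Qed.

End Polygon.

End CyclicOrder.

(** * Zigzag triangulations *)

Lemma image_graphE (V W : finType) (f : V -> W) (h : W -> V) (e : rel V) :
  cancel f h -> cancel h f -> image_graph f e =2 relpre h e.
Proof.
move=> fK hK i j; apply/existsP/idP => [[x /existsP[y /and3P[exy /eqP <- /eqP <-]]]|ehh].
  by rewrite /= !fK.
by exists (h i); apply/existsP; exists (h j); rewrite !hK !eqxx !andbT.
Qed.

Lemma boundary_edge_comp (R : realType) n (p : 'I_n -> 'rV[R]_2) (s : 'I_n -> 'I_n) i j :
  injective s -> boundary_edge p (s i) (s j) <-> boundary_edge (p \o s) i j.
Proof.
move=> s_inj; rewrite /boundary_edge (inj_eq s_inj).
have inE2 k : (s k \in [set s i; s j]) = (k \in [set i; j]).
  by rewrite !inE !(inj_eq s_inj).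
split=> -[ij [u [c hu]]]; split=> //; exists u, c => k; first by rewrite -inE2; apply: hu.
have [s' sK s'K] := injF_bij s_inj.
by rewrite -(s'K k) inE2; apply: hu.
Qed.

Lemma set2_eq (T : finType) (a b c d : T) : [set a; b] = [set c; d] ->
  (a = c /\ b = d) \/ (a = d /\ b = c).
Proof.
move=> h.
have : a \in [set c; d] by rewrite -h !inE eqxx.
have : b \in [set c; d] by rewrite -h !inE eqxx orbT.
have : c \in [set a; b] by rewrite h !inE eqxx.
have : d \in [set a; b] by rewrite h !inE eqxx orbT.
rewrite !inE => /orP[]/eqP d1 /orP[]/eqP c1 /orP[]/eqP b1 /orP[]/eqP a1; subst; auto.
Qed.

(* The zigzag path visits the polygon vertices 0, 1, n-1, 2, n-2, ... in this
   order; [zigzag n t] is the rank of vertex t on it ([0.*2.-1] being 0). *)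
Definition zigzag n t := if t <= n./2 then t.*2.-1 else (n - t).*2.

(** The entry of [a] of rank [zigzag n t] is placed at polygon vertex [t]. Ends of a side or of a
    zigzag diagonal have ranks differing by at most 2, so [spread] keeps these segments free of
    edges of [e]. *)
Lemma potentially_triangulable_spread (R : realType) (n : nat) (p : 'I_n -> 'rV[R]_2)
    (V : finType) (e : rel V) (a : seq V) :
  convex_position p -> #|V| = n -> symmetric e ->
  uniq a -> a =i predT -> spread e a -> potentially_triangulable p e.
Proof.
move=> convP cardV symE Ua fulla spr.
have sza : size a = n by rewrite -cardV -(card_uniqP Ua); apply: eq_card.
case: n p convP cardV sza => [|n] p convP cardV sza.
  (* The empty polygon is treated apart, since [nth] requires a default vertex. *)
  have V0 : V -> False by move=> v; have := fulla v; case: (a) sza.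
  exists (fun v => match V0 v with end); split.
    by exists (fun i : 'I_0 => match notF (ltn_ord i) with end) => [v|[]//]; case: (V0 v).
  split=> [[]//|]; exists set0; split; rewrite ?cards0 //.
    by move=> E; rewrite inE.
  by move=> [].
have v0 : V by case: (a) sza.
have [s s_inj ccwq] := cyclic_order convP.
have [t sK tK] := injF_bij s_inj.
pose h i := nth v0 a (zigzag n.+1 (t i)).
have zlt i : i < n.+1 -> zigzag n.+1 i < n.+1.
  by rewrite /zigzag => hi; case: ifP; lia.
have h_inj : injective h.
  move=> i j /eqP; rewrite /h nth_uniq ?sza ?zlt // => /eqP hij.
  apply: (can_inj tK); apply/val_inj; move: hij (ltn_ord (t i)) (ltn_ord (t j)).
  by rewrite /zigzag /=; case: ifP; case: ifP; lia.
have cVI : #|V| <= #|'I_n.+1| by rewrite cardV card_ord.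
have [f hK fK] := inj_card_bij h_inj cVI.
have near x y : zigzag n.+1 x < zigzag n.+1 y <= (zigzag n.+1 x).+2 ->
    x < n.+1 -> y < n.+1 ->
    ~~ e (nth v0 a (zigzag n.+1 x)) (nth v0 a (zigzag n.+1 y)).
  move=> /andP[xy yx] hx hy; move/(spread_nth v0): spr; apply=> //.
  by rewrite sza zlt.
have nearE (x y : 'I_n.+1) : x != y -> zigzag n.+1 x <= (zigzag n.+1 y).+2 ->
    zigzag n.+1 y <= (zigzag n.+1 x).+2 ->
    delete_edges (@complete_graph 'I_n.+1) (image_graph f e) (s x) (s y).
  move=> xy h1 h2; rewrite /delete_edges /complete_graph (inj_eq s_inj) xy /=.
  rewrite (image_graphE _ fK hK) /= /h !sK.
  have neq : zigzag n.+1 x != zigzag n.+1 y.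
    apply: contraNneq xy => zz; apply/eqP/s_inj/h_inj; by rewrite /h !sK zz.
  case: (ltngtP (zigzag n.+1 x) (zigzag n.+1 y)) neq => // hlt _.
    by apply: near; rewrite ?hlt.
  by rewrite symE; apply: near; rewrite ?hlt.
exists f; split; first by exists h.
split.
  move=> i j; rewrite -(tK i) -(tK j) => /(boundary_edge_comp _ _ _ s_inj).
  wlog ltij : i j / t i < t j.
    move=> W; case: (ltngtP (t i) (t j)) => [|tji|/val_inj tij]; first exact: W.
      move=> /boundary_edgeC /(W _ _ tji); rewrite /delete_edges /complete_graph.
      rewrite eq_sym !(image_graphE _ fK hK) /= symE //.
    by case; rewrite tij eqxx.
  move/(boundary_edge_consecutive ccwq ltij) => hc.
  have := ltn_ord (t i); have := ltn_ord (t j).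
  by move=> hj hi; apply: nearE; [rewrite -val_eqE /=; lia| |];
    move: hc; rewrite /zigzag; case: ifP; case: ifP; lia.
(* Diagonal [m] joins the vertices of ranks [m + 1] and [m + 2] on the zigzag path, whose first and
   last steps are sides. *)
pose lo (m : 'I_(n.+1 - 3)) : 'I_n.+1 := inord (m.+1./2.+1).
pose hi (m : 'I_(n.+1 - 3)) : 'I_n.+1 := inord (n.+1 - uphalf m.+1).
have loE m : lo m = m.+1./2.+1 :> nat by rewrite inordK //; have := ltn_ord m; lia.
have hiE m : hi m = n.+1 - uphalf m.+1 :> nat.
  by rewrite inordK //; have := ltn_ord m; lia.
have lohi m : lo m < hi m by rewrite loE hiE; have := ltn_ord m; lia.
pose diag m := [set s (lo m); s (hi m)].
have diagE i j m : [set i; j] = diag m ->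
    (i = s (lo m) /\ j = s (hi m)) \/ (i = s (hi m) /\ j = s (lo m)) by apply: set2_eq.
exists [set diag m | m : 'I_(n.+1 - 3)]; split.
- rewrite card_imset ?card_ord // => m m' /set2_eq.
  have := lohi m; have := lohi m' => l1 l2.
  case=> -[/s_inj h1 /s_inj h2]; last by move: l1 l2; rewrite h1 h2; lia.
  apply: val_inj; move: (congr1 val h1) (congr1 val h2) (ltn_ord m) (ltn_ord m').
  by rewrite /= !loE !hiE; lia.
- move=> E /imsetP[m _ ->]; exists (s (lo m)), (s (hi m)).
  have hm := ltn_ord m; have hlo := loE m; have hhi := hiE m; have hl := lohi m.
  have nlh : lo m != hi m by rewrite -val_eqE /=; lia.
  split=> //; first by rewrite (inj_eq s_inj).
    by apply: nearE => //; rewrite /zigzag hlo hhi; case: ifP; case: ifP; lia.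
  move/(boundary_edge_comp _ _ _ s_inj)/(boundary_edge_consecutive ccwq hl).
  by rewrite hlo hhi; lia.
move=> i j k l /imsetP[m _ em] /imsetP[m' _ em']; rewrite em em' => neq.
(* As [m] grows, [lo] does not decrease and [hi] does not increase, so distinct diagonals are
   nested, possibly with a common end. *)
have base : ~ segments_cross (p (s (lo m))) (p (s (hi m)))
                             (p (s (lo m'))) (p (s (hi m'))).
  have mm : m != m' :> nat by apply: contraNneq neq => /val_inj ->.
  have hm := ltn_ord m; have hm' := ltn_ord m'.
  by apply: (no_cross_nested ccwq (lohi m) (lohi m')); rewrite !loE !hiE; lia.
case/diagE: em => -[-> ->]; case/diagE: em' => -[-> ->] //.
- by move/segments_crossCr.
- by move/segments_crossCl.
- by move/segments_crossCl/segments_crossCr.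
Qed.

(** * Exceptional graphs *)

Definition interleaved (u v : nat * nat) : bool :=
  [&& u.1 < v.1, v.1 < u.2 & u.2 < v.2] || [&& v.1 < u.1, u.1 < v.2 & v.2 < u.2].

(** Exhaustive branching; [chosen] holds the pairs already kept, which are not counted in the
    value. *)
Fixpoint max_noncrossing (chosen s : seq (nat * nat)) : nat :=
  if s is u :: s' then
    maxn (max_noncrossing chosen s')
      (if has (interleaved u) chosen then 0 else (max_noncrossing (u :: chosen) s').+1)
  else 0.

(** The branch that keeps the entries of [t] and skips the others is among those explored. *)
Lemma size_noncrossing (chosen s t : seq (nat * nat)) :
  subseq t s -> {in t & chosen ++ t, forall u v, ~~ interleaved u v} ->
  size t <= max_noncrossing chosen s.
Proof.
elim: s chosen t => [|u s IHs] chosen [|v t] //= sub nc.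
move: sub; case: eqP => [vu|_] sub; rewrite leq_max; last first.
  by apply/orP; left; apply: IHs sub nc.
apply/orP; right; subst v.
have -> : has (interleaved u) chosen = false.
  by apply/hasPn => w wc; apply: nc; rewrite ?inE ?eqxx // mem_cat wc.
rewrite ltnS; apply: IHs => // x y xt; rewrite mem_cat inE -orbA => hy.
apply: nc; first by rewrite inE xt orbT.
by rewrite mem_cat inE; case/or3P: hy => ->; rewrite ?orbT.
Qed.

Definition consecutive n i j := (j == i.+1) || (i == 0) && (j == n.-1).

Definition index_pairs n :=
  [seq u <- [seq (i, j) | i <- iota 0 n, j <- iota 0 n] | u.1 < u.2].

Definition allowed (M : rel nat) n (l : seq nat) : seq (nat * nat) :=
  [seq u <- index_pairs n | ~~ M (nth 0 l u.1) (nth 0 l u.2)].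

(* Polygon vertex [i] carries vertex [nth 0 l i] of the graph [M]: some side of
   the polygon is an edge of [M], or too few noncrossing diagonals avoid [M]. *)
Definition label_obstructed (M : rel nat) n (l : seq nat) : bool :=
  has (fun u => consecutive n u.1 u.2 && M (nth 0 l u.1) (nth 0 l u.2)) (index_pairs n) ||
  (max_noncrossing [::] [seq u <- allowed M n l | ~~ consecutive n u.1 u.2] < n - 3).

Definition obstructed (M : rel nat) n : bool :=
  all (label_obstructed M n) (permutations (iota 0 n)).

Lemma mem_index_pairs n i j : ((i, j) \in index_pairs n) = (i < j < n).
Proof.
rewrite mem_filter /=; apply/idP/idP => [/andP[ij /allpairsP[[x y] /= [hx hy [ex ey]]]]|].
  by subst x y; move: hx hy; rewrite !mem_iota; move: ij; lia.
move=> /andP[ij jn]; rewrite ij /=; apply/allpairsP; exists (i, j) => /=.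
by rewrite !mem_iota; split=> //; lia.
Qed.

(** A placement read along the counterclockwise polygon is a permutation [L] of the labels. By
    [obstructed], either a side carries an edge of [M], or the diagonals in [D], listed as index
    pairs in [T], outnumber the maximum found by the search. *)
Lemma not_potentially_triangulable (R : realType) (n : nat) (p : 'I_n -> 'rV[R]_2)
    (V W : finType) (e : rel V) (e' : rel W) (M : rel nat) (lab : W -> nat) :
  convex_position p -> #|V| = n -> symmetric e -> isomorphic e e' ->
  injective lab -> (forall w, lab w < n) -> (forall w w', e' w w' = M (lab w) (lab w')) ->
  obstructed M n -> ~ potentially_triangulable p e.
Proof.
move=> convP cardV symE [phi [[psi phiK psiK] phiE]] lab_inj lab_lt labE obs.
case=> f [[h fK hK] [bd [D [cardD diagD ncD]]]].
have [s s_inj ccwq] := cyclic_order convP.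
have [t sK tK] := injF_bij s_inj.
pose L := [seq lab (phi (h (s i))) | i <- enum 'I_n].
have szL : size L = n by rewrite size_map size_enum_ord.
have pL : perm_eq L (iota 0 n).
  have sub : {subset L <= iota 0 n}.
    by move=> x /mapP[i _ ->]; rewrite mem_iota /= add0n.
  have uL : uniq L.
    rewrite map_inj_uniq ?enum_uniq // => i j /lab_inj /(can_inj phiK) /(can_inj hK).
    exact: s_inj.
  have [|_ LE] := uniq_min_size uL sub; first by rewrite size_iota szL.
  by apply: uniq_perm; rewrite ?iota_uniq.
have LE (i : 'I_n) : nth 0 L i = lab (phi (h (s i))).
  by rewrite (nth_map i) ?size_enum_ord // nth_ord_enum.
have ME (i j : 'I_n) : M (nth 0 L i) (nth 0 L j) = e (h (s i)) (h (s j)).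
  by rewrite !LE -labE phiE.
have avoid (i j : 'I_n) :
    delete_edges (@complete_graph 'I_n) (image_graph f e) (s i) (s j) ->
    ~~ M (nth 0 L i) (nth 0 L j).
  by case/andP=> _; rewrite (image_graphE _ fK hK) ME.
have := allP obs L; rewrite mem_permutations pL => /(_ isT) /orP[].
  case/hasP=> -[i j]; rewrite mem_index_pairs /= => /andP[ij jn] /andP[cij Mij].
  have hin := ltn_trans ij jn.
  have /avoid : delete_edges (@complete_graph 'I_n) (image_graph f e)
      (s (Ordinal hin)) (s (Ordinal jn)).
    apply: bd; apply/(boundary_edge_comp _ _ _ s_inj).
    exact: (consecutive_boundary_edge (i := Ordinal hin) (j := Ordinal jn) ccwq ij cij).
  by rewrite /= Mij.
pose isD (u : nat * nat) :=
  [exists i : 'I_n, [exists j : 'I_n, [&& u.1 == i, u.2 == j & [set s i; s j] \in D]]].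
set A := [seq u <- allowed M n L | _] => hlt.
pose T := [seq u <- A | isD u].
have isDE (i j : 'I_n) : isD (i : nat, j : nat) = ([set s i; s j] \in D).
  apply/existsP/idP => [[x /existsP[y /and3P[/eqP/val_inj -> /eqP/val_inj -> //]]]|hD].
  by exists i; apply/existsP; exists j; rewrite !eqxx.
have TP u : u \in T ->
    exists i j : 'I_n, [/\ u = (i : nat, j : nat), i < j & [set s i; s j] \in D].
  rewrite 3!mem_filter => /and4P[hD _ _ hu]; case: u hD hu => x y.
  rewrite mem_index_pairs => hD /andP[xy yn].
  exists (Ordinal (ltn_trans xy yn)), (Ordinal yn); split=> //.
  by rewrite -isDE.
have sT : size T <= max_noncrossing [::] A.
  apply: size_noncrossing; first exact: filter_subseq.
  move=> u v /TP[i [j [-> ij hD]]] /TP[k [l [-> kl hD']]].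
  apply/negP => cr; apply: (ncD _ _ _ _ hD hD').
    apply/eqP => /set2_eq [[/s_inj ? /s_inj ?]|[/s_inj ? /s_inj ?]]; subst.
      by move: cr; rewrite /interleaved /=; lia.
    by move: cr ij kl; rewrite /interleaved /=; lia.
  case/orP: cr => /and3P[/= h1 h2 h3]; first exact: (cross_interleaved ccwq).
  have [x [x1 x2]] := cross_interleaved ccwq h1 h2 h3.
  by exists x.
have : #|D| <= size T.
  (* [F] turns a pair of polygon indices back into a pair of point labels; its values on [T] cover
     [D]. *)
  pose F (u : nat * nat) : {set 'I_n} :=
    [set x | (val (t x) == u.1) || (val (t x) == u.2)].
  have FE (i j : 'I_n) : F (i : nat, j : nat) = [set s i; s j].
    apply/setP => x; rewrite !inE.
    by rewrite -(inj_eq (can_inj tK) x) sK -(inj_eq (can_inj tK) x (s j)) sK.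
  rewrite -(size_map F); apply: leq_trans (card_size _).
  apply/subset_leq_card/subsetP => E ED; have [i [j [EE ij gij nb]]] := diagD _ ED.
  wlog tij : i j EE ij gij nb / t i < t j.
    move=> W0; case: (ltngtP (t i) (t j)) => [|tji|/val_inj/(can_inj tK) eij].
    - exact: W0.
    - apply: (W0 j i); rewrite ?EE 1?setUC 1?eq_sym //.
        move: gij; rewrite /delete_edges /complete_graph !(image_graphE _ fK hK) /=.
        by rewrite eq_sym symE.
      by move/boundary_edgeC.
    - by rewrite eij eqxx in ij.
  apply/mapP; exists (t i : nat, t j : nat); last by rewrite FE !tK.
  have nc : ~~ consecutive n (t i) (t j).
    by apply/negP => /(consecutive_boundary_edge ccwq tij)/(boundary_edge_comp _ _ _ s_inj);
      rewrite !tK.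
  rewrite 3!mem_filter isDE !tK -EE ED nc mem_index_pairs /= tij ltn_ord !andbT.
  by apply: avoid; rewrite !tK.
by rewrite cardD leqNgt (leq_ltn_trans sT hlt).
Qed.

(** * Computable forms of the excluded graphs *)

Definition cycle_rel k i j := (j == i.+1 %% k) || (i == j.+1 %% k).

(** The second cycle uses the labels from [k1] on; the guards reject mixed pairs, where the
    truncated subtraction would mislead. *)
Definition two_cycles_rel k1 k2 i j :=
  if (i < k1) && (j < k1) then cycle_rel k1 i j
  else [&& k1 <= i, k1 <= j & cycle_rel k2 (i - k1) (j - k1)].

Lemma cycle_not_triangulable (R : realType) (n k : nat) (p : 'I_n -> 'rV[R]_2)
    (V : finType) (e : rel V) :
  convex_position p -> #|V| = n -> symmetric e -> isomorphic e (@cycle_graph k) ->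
  obstructed (cycle_rel k) k -> ~ potentially_triangulable p e.
Proof.
move=> convP cardV symE iso obs.
have nk : n = k.
  by case: iso => f [bf _]; rewrite -cardV (bij_eq_card bf) card_ord.
subst k; apply: (not_potentially_triangulable convP cardV symE iso _ _ _ obs (lab := val)).
- exact: val_inj.
- exact: ltn_ord.
- by [].
Qed.

Lemma two_cycles_not_triangulable (R : realType) (n k1 k2 : nat) (p : 'I_n -> 'rV[R]_2)
    (V : finType) (e : rel V) :
  convex_position p -> #|V| = n -> symmetric e ->
  isomorphic e (disjoint_union (@cycle_graph k1) (@cycle_graph k2)) ->
  obstructed (two_cycles_rel k1 k2) (k1 + k2) -> ~ potentially_triangulable p e.
Proof.
move=> convP cardV symE iso obs.
have nk : n = k1 + k2.
  by case: iso => f [bf _]; rewrite -cardV (bij_eq_card bf) card_sum !card_ord.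
rewrite -nk in obs; pose lab (u : 'I_k1 + 'I_k2) : nat :=
  match u with inl i => i | inr j => k1 + j end.
apply: (not_potentially_triangulable convP cardV symE iso _ _ _ obs (lab := lab)).
- case=> i [] j /= h; try by [have := ltn_ord i; have := ltn_ord j; lia].
    by congr inl; apply: val_inj.
  by congr inr; apply: val_inj => /=; lia.
- by rewrite nk; case=> i /=; have := ltn_ord i; lia.
case=> i [] j; rewrite /two_cycles_rel /=.
- by rewrite !ltn_ord.
- by rewrite ltn_ord [k1 + j < k1]ltnNge leq_addr /= leqNgt ltn_ord.
- by rewrite ltnNge leq_addr /= [k1 <= j]leqNgt ltn_ord.
- by rewrite ltnNge leq_addr /= leq_addr !addKn.
Qed.

(** * The equivalence *)

Theorem theorem5 (R : realType) (n : nat) (p : 'I_n -> 'rV[R]_2)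
    (V : finType) (e : rel V) :
  convex_position p ->
  #|V| = n ->
  simple_graph e ->
  regular 2 e ->
  potentially_triangulable p e <->
  ~ (isomorphic e (@cycle_graph 3) \/
     isomorphic e (@cycle_graph 4) \/
     isomorphic e (@cycle_graph 5) \/
     isomorphic e (@cycle_graph 6) \/
     isomorphic e (disjoint_union (@cycle_graph 3) (@cycle_graph 3)) \/
     isomorphic e (disjoint_union (@cycle_graph 3) (@cycle_graph 4))).
Proof.
move=> convP cardV [symE irrE] regE; split=> [pt|noniso].
  case=> [|[|[|[|[|]]]]] iso; move: pt.
  (* The excluded graphs have at most 7 vertices, so each evaluation of [obstructed] runs over at
     most 5040 labellings. *)
  - by apply: (cycle_not_triangulable convP cardV symE iso); vm_compute.
  - by apply: (cycle_not_triangulable convP cardV symE iso); vm_compute.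
  - by apply: (cycle_not_triangulable convP cardV symE iso); vm_compute.
  - by apply: (cycle_not_triangulable convP cardV symE iso); vm_compute.
  - by apply: (two_cycles_not_triangulable convP cardV symE iso); vm_compute.
  - by apply: (two_cycles_not_triangulable convP cardV symE iso); vm_compute.
have [cs [U full hcs ecs]] := cycle_decomposition symE irrE regE.
case: (arrangeable_or_short U hcs) => [[a pa spr]|exceptional].
  apply: (potentially_triangulable_spread convP cardV symE (a := a)).
  - by rewrite (perm_uniq pa).
  - by move=> x; rewrite (perm_mem pa) full.
  - by rewrite (spread_eq (e' := cycles_rel cs)) // => x y _ _; apply: ecs.
case: noniso; case: exceptional => [[c csE c6]|[c [d [pcs c3 d34]]]].
  subst cs; move: hcs => /=; rewrite andbT => c2.
  have := isomorphic_cycle (ltnW (ltnW c2)) U full ecs.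
  case: (size c) c2 c6 => [|[|[|[|[|[|[|]]]]]]] // _ _; tauto.
have ecd : e =2 cycles_rel [:: c; d].
  by move=> x y; rewrite ecs; apply: perm_cycles_rel.
have fcd : flatten [:: c; d] =i predT.
  by move=> x; rewrite -(perm_mem (perm_flatten pcs)) full.
have Ucd : uniq (flatten [:: c; d]) by rewrite -(perm_uniq (perm_flatten pcs)).
have := isomorphic_two_cycles _ Ucd fcd ecd; rewrite c3 => /(_ isT).
by case: d34 => ->; tauto.
Qed.
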